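(* Let $a\in\mathbb R$, $\lambda>0$ with $|a|<\lambda$, and fix $\Delta x,\Delta t>0$ with $\lambda\sigma\le1$, $\sigma=\Delta t/\Delta x$, and an integer $N\ge1$. Fix a real sequence $(u_j^0)_{j\in\mathbb Z}$, independent of $\varepsilon$, with $\sum_{j\in\mathbb Z}(u_{j+1}^0-u_j^0)^2<\infty$. For each $\varepsilon>0$ let $(\mathbf U_j^n)$, $\mathbf U_j^n=(u_j^n,v_j^n)^\top$, be generated by the staggered scheme with parameter $\varepsilon$ from the well-prepared data $(u_j^0,v_j^0)$, $v_j^0=au_j^0$, and let $(\bar u_j^n)$ be the solution of the limiting staggered scheme with $\bar u_j^0=u_j^0$ (both schemes are given in the context). Put $$\alpha=\frac{2\varepsilon}{2\varepsilon+\Delta t},\qquad \Theta_N(\varepsilon)=\varepsilon\,\frac{1-\alpha^{2N}}{1+\alpha}.$$ Then there is a constant $C>0$, which may depend on the fixed discretization parameters, on $N$, on $a,\lambda$ and on the initial data but not on $\varepsilon$, such that $$\Phi_{\mathrm{rel}}^N\le C\bigl(\alpha^2+\Theta_N(\varepsilon)^2\bigr).$$ Consequently, for fixed $\Delta x,\Delta t,N$, $\Phi_{\mathrm{rel}}^N=O(\varepsilon^2)$ in the regime $\varepsilon\ll\Delta t$ (i.e. as $\varepsilon\to0$).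
   Context: Staggered scheme: intermediate states $\mathbf U_{j+\frac12}^{n+\frac12}=(u_{j+\frac12}^{n+\frac12},v_{j+\frac12}^{n+\frac12})^\top$ live at interfaces. For $j\in\mathbb Z$, $n\in\mathbb N$, with $e:=e^{-\Delta t/(2\varepsilon)}$, $$u_{j-\frac12}^{n+\frac12}=\tfrac{u_{j-1}^n+u_j^n}{2}-\tfrac\sigma2\Bigl(au_j^n+e(v_j^n-au_j^n)-au_{j-1}^n-e(v_{j-1}^n-au_{j-1}^n)\Bigr),$$ $$v_{j-\frac12}^{n+\frac12}=\Bigl(1+\tfrac{\Delta t}{2\varepsilon}\Bigr)^{-1}\Bigl[\tfrac{v_{j-1}^n+v_j^n}{2}-\tfrac{\lambda^2\sigma}{2}(u_j^n-u_{j-1}^n)+\tfrac{\Delta t}{2\varepsilon}a\,u_{j-\frac12}^{n+\frac12}\Bigr],$$ $$u_j^{n+1}=\tfrac{u_{j-\frac12}^{n+\frac12}+u_{j+\frac12}^{n+\frac12}}{2}-\tfrac\sigma2\Bigl(au_{j+\frac12}^{n+\frac12}+e(v_{j+\frac12}^{n+\frac12}-au_{j+\frac12}^{n+\frac12})-au_{j-\frac12}^{n+\frac12}-e(v_{j-\frac12}^{n+\frac12}-au_{j-\frac12}^{n+\frac12})\Bigr),$$ $$v_j^{n+1}=\Bigl(1+\tfrac{\Delta t}{2\varepsilon}\Bigr)^{-1}\Bigl[\tfrac{v_{j-\frac12}^{n+\frac12}+v_{j+\frac12}^{n+\frac12}}{2}-\tfrac{\lambda^2\sigma}{2}(u_{j+\frac12}^{n+\frac12}-u_{j-\frac12}^{n+\frac12})+\tfrac{\Delta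 t}{2\varepsilon}a\,u_j^{n+1}\Bigr].$$ Limiting staggered scheme: $$\bar u_{j-\frac12}^{n+\frac12}=\tfrac{\bar u_{j-1}^n+\bar u_j^n}{2}-\tfrac{a\sigma}{2}(\bar u_j^n-\bar u_{j-1}^n),\qquad \bar u_j^{n+1}=\tfrac{\bar u_{j-\frac12}^{n+\frac12}+\bar u_{j+\frac12}^{n+\frac12}}{2}-\tfrac{a\sigma}{2}(\bar u_{j+\frac12}^{n+\frac12}-\bar u_{j-\frac12}^{n+\frac12}).$$ Global discrete relative entropy: with $H=\begin{pmatrix}\lambda^2&-a\\-a&1\end{pmatrix}$ and $\bar{\mathbf U}_j^n=(\bar u_j^n,a\bar u_j^n)^\top$, $$\Phi_{\mathrm{rel}}^n=\frac{\Delta x}{2}\sum_{j\in\mathbb Z}(\mathbf U_j^n-\bar{\mathbf U}_j^n)^\top H(\mathbf U_j^n-\bar{\mathbf U}_j^n).$$ *)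

(* Defs.v *)
From HB Require Import structures.
From mathcomp Require Import all_boot all_order all_algebra.
From mathcomp Require Import all_classical all_reals all_analysis.

Set Implicit Arguments.
Unset Strict Implicit.
Unset Printing Implicit Defensive.

Import Order.TTheory GRing.Theory Num.Theory.
Import numFieldNormedType.Exports.

Local Open Scope ring_scope.

(* A state (u, v) is a pair. The two half-steps of the scheme are given by the
   same formula, applied to the states Ul and Ur located half a cell to the
   left and half a cell to the right of the point being updated. *)
Definition staggered_u (R : realType) (a dx dt eps : R) (Ul Ur : R * R) : R :=
  let sigma := dt / dx in
  let e := expR (- (dt / (2 * eps))) in
  (Ul.1 + Ur.1) / 2
  - sigma / 2 * (a * Ur.1 + e * (Ur.2 - a * Ur.1)
                 - a * Ul.1 - e * (Ul.2 - a * Ul.1)).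

Definition staggered_v (R : realType) (a lam dx dt eps : R) (Ul Ur : R * R)
    : R :=
  let sigma := dt / dx in
  (1 + dt / (2 * eps))^-1
  * ((Ul.2 + Ur.2) / 2 - lam ^+ 2 * sigma / 2 * (Ur.1 - Ul.1)
     + dt / (2 * eps) * a * staggered_u a dx dt eps Ul Ur).

Definition staggered_update (R : realType) (a lam dx dt eps : R)
    (Ul Ur : R * R) : R * R :=
  (staggered_u a dx dt eps Ul Ur, staggered_v a lam dx dt eps Ul Ur).

(* In a sequence of interface values, the index j stands for j - 1/2. *)
Definition to_interfaces (S : Type) (update : S -> S -> S) (U : int -> S)
    : int -> S :=
  fun j => update (U (j - 1)) (U j).

Definition to_cells (S : Type) (update : S -> S -> S) (Uh : int -> S)
    : int -> S :=
  fun j => update (Uh j) (Uh (j + 1)).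

(* U^n_j for the staggered scheme with well-prepared data v^0 = a u^0. *)
Definition staggered (R : realType) (a lam dx dt eps : R) (u0 : int -> R)
    (n : nat) : int -> R * R :=
  let F := staggered_update a lam dx dt eps in
  iter n (fun U => to_cells F (to_interfaces F U)) (fun j => (u0 j, a * u0 j)).

Definition limit_update (R : realType) (a dx dt : R) (ul ur : R) : R :=
  let sigma := dt / dx in
  (ul + ur) / 2 - a * sigma / 2 * (ur - ul).

Definition limit_staggered (R : realType) (a dx dt : R) (u0 : int -> R)
    (n : nat) : int -> R :=
  let F := limit_update a dx dt in
  iter n (fun u => to_cells F (to_interfaces F u)) u0.

Definition state_vec (R : realType) (U : R * R) : 'cV[R]_2 :=
  \col_(i < 2) (if i == 0 then U.1 else U.2).

Definition entropy_mx (R : realType) (a lam : R) : 'M[R]_2 :=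
  \matrix_(i < 2, j < 2)
    (if i == j then (if i == 0 then lam ^+ 2 else 1) else - a).

Definition rel_entropy_density (R : realType) (a lam : R) (U : R * R)
    (ubar : R) : R :=
  let W := state_vec U - state_vec (ubar, a * ubar) in
  (W^T *m entropy_mx a lam *m W) 0 0.

(* For |a| < lam the matrix entropy_mx a lam is positive definite, so the terms
   are nonnegative and \esum (a supremum of finite partial sums) is the sum of
   the series, with value +oo when it diverges. *)
Definition Phi_rel (R : realType) (a lam dx dt : R) (u0 : int -> R) (N : nat)
    (eps : R) : \bar R :=
  ((dx / 2)%:E *
   \esum_(j in [set: int])
     (rel_entropy_density a lam (staggered a lam dx dt eps u0 N j)
        (limit_staggered a dx dt u0 N j))%:E)%E.

Definition alpha (R : realType) (dt eps : R) : R :=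
  2 * eps / (2 * eps + dt).

Definition Theta (R : realType) (dt : R) (N : nat) (eps : R) : R :=
  eps * ((1 - alpha dt eps ^+ (2 * N)) / (1 + alpha dt eps)).

(* Main.v *)
Require Import Defs.
From HB Require Import structures.
From mathcomp Require Import all_boot all_order all_algebra.
From mathcomp Require Import all_classical all_reals all_analysis.
From mathcomp Require Import ring lra.

Set Implicit Arguments.
Unset Strict Implicit.
Unset Printing Implicit Defensive.

Import Order.TTheory GRing.Theory Num.Theory.
Import numFieldNormedType.Exports.

Local Open Scope classical_set_scope.
Local Open Scope ring_scope.

(** Write [w := v - a u] for the distance to equilibrium, [d := u - ubar] for
the error, and [sigma := dt / dx], [e := expR (- dt / (2 eps))].  One half-step
of the staggered scheme reads, in these variables,
  [w' = alpha ((wl + wr) / 2 - (lam^2 - a^2) sigma / 2 (ur - ul)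
               + a sigma e / 2 (wr - wl))],
  [d' = (dl + dr) / 2 - a sigma / 2 (dr - dl) - sigma e / 2 (wr - wl)],
because the implicit relaxation contributes the factor
[(1 + dt / (2 eps))^-1 = alpha] ([staggered_disequilibrium],
[staggered_error]).  So [w'] carries a factor [alpha], provided that the
increments of [u] are bounded in l2 uniformly in [eps]; and [0 < alpha, e <= 1]
keep these increments bounded from one half-step to the next.  Hence, after
finitely many half-steps starting from [w = 0] and [d = 0], the three estimates
  increments of [u] are O(1),   [w] is O(alpha),   [d] is O(alpha)
hold in l2(Z), uniformly in [eps > 0] ([close_to_limit_half_step],
[close_to_limit_staggered]).  The constants grow with the number of steps,
which is fixed.

The relative entropy density is [(lam^2 - a^2) d^2 + w^2]
([rel_entropy_densityE]), so that [Phi_rel <= C alpha^2], which is stronger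
than the bound by [C (alpha^2 + Theta^2)].  The O([eps^2]) estimate follows
from [alpha <= 2 eps / dt]. *)

(** * Square-summable families of sequences *)

Lemma le_esumZ (R : realType) (c B : R) (f : int -> R) : 0 <= c ->
  (forall j, 0 <= f j) ->
  (\esum_(j in [set: int]) (f j)%:E <= B%:E)%E ->
  (\esum_(j in [set: int]) (c * f j)%:E <= (c * B)%:E)%E.
Proof.
move=> c0 f0 fB; apply: ge_ereal_sup => _ [X [finX _] <-].
rewrite fsbig_finite//= sumEFin -mulr_sumr lee_fin ler_wpM2l//.
rewrite -lee_fin (le_trans _ fB)// esum_ge//; exists X => //.
by rewrite fsbig_finite//= sumEFin.
Qed.

(** [l2O c f]: the l2(Z)-norm of the sequence [f eps] is at most a constant
times [`|c eps|], uniformly in [eps > 0].  The constant [K] bounds the square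
of the norm. *)
Definition l2O (R : realType) (c : R -> R) (f : R -> int -> R) : Prop :=
  exists2 K : R, 0 <= K & forall eps : R, 0 < eps ->
    (\esum_(j in [set: int]) (f eps j ^+ 2)%:E <= (K * c eps ^+ 2)%:E)%E.

Section L2OTheory.
Variable R : realType.
Implicit Types (c : R -> R) (f g : R -> int -> R).

Lemma eq_l2O c f g : (forall eps j, 0 < eps -> g eps j = f eps j) ->
  l2O c f -> l2O c g.
Proof.
move=> fg [K K0 fK]; exists K => // eps eps0.
by under eq_esum => j _ do rewrite fg//; exact: fK.
Qed.

Lemma l2O0 c : l2O c (fun _ _ => 0).
Proof.
exists 0 => // eps _; rewrite mul0r esum1// => j _.
by rewrite expr0n.
Qed.

Lemma l2OD c f g : l2O c f -> l2O c g ->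
  l2O c (fun eps j => f eps j + g eps j).
Proof.
move=> [K K0 fK] [L L0 gL]; exists (2 * K + 2 * L).
  by rewrite addr_ge0// mulr_ge0.
move=> eps eps0; rewrite mulrDl -!mulrA EFinD.
apply: (@le_trans _ _ (\esum_(j in [set: int]) ((2 * f eps j ^+ 2)%:E
    + (2 * g eps j ^+ 2)%:E))%E).
  apply: le_esum => j _; rewrite -EFinD lee_fin -subr_ge0.
  (* 2 x^2 + 2 y^2 - (x + y)^2 = (x - y)^2 *)
  rewrite [leRHS](_ : _ = (f eps j - g eps j) ^+ 2) ?sqr_ge0//; ring.
rewrite esumD; last 2 first.
- by move=> j _; rewrite lee_fin mulr_ge0// sqr_ge0.
- by move=> j _; rewrite lee_fin mulr_ge0// sqr_ge0.
by apply: leeD; apply: le_esumZ => //;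
  [move=> j; exact: sqr_ge0|exact: fK|move=> j; exact: sqr_ge0|exact: gL].
Qed.

(** The multiplier [m] may turn the order [c] into another order [c']. *)
Lemma l2OM (m c c' : R -> R) (M : R) f :
  (forall eps, 0 < eps -> `|m eps * c eps| <= M * `|c' eps|) ->
  l2O c f -> l2O c' (fun eps j => m eps * f eps j).
Proof.
move=> mM [K K0 fK]; exists (K * M ^+ 2); first by rewrite mulr_ge0// sqr_ge0.
move=> eps eps0; under eq_esum => j _ do rewrite exprMn.
apply: (@le_trans _ _ (m eps ^+ 2 * (K * c eps ^+ 2))%:E).
  by apply: le_esumZ; [exact: sqr_ge0|move=> j; exact: sqr_ge0|exact: fK].
rewrite lee_fin mulrCA -mulrA ler_wpM2l// -!exprMn -ler_sqrt ?sqr_ge0//.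
rewrite !sqrtr_sqr (le_trans (mM _ eps0))// normrM ler_wpM2r//.
exact: ler_norm.
Qed.

Lemma l2OZ (k : R) c f : l2O c f -> l2O c (fun eps j => k * f eps j).
Proof. by apply: (l2OM (M := `|k|)) => eps _; rewrite normrM. Qed.

Lemma l2O_shift (k : int) c f :
  l2O c f -> l2O c (fun eps j => f eps (j + k)).
Proof.
move=> [K K0 fK]; exists K => // eps eps0.
rewrite -(reindex_esum [set: int] [set: int] (fun j => j + k)
  (fun j => (f eps j ^+ 2)%:E)); first exact: fK.
split=> //.
- by move=> i j _ _ /addIr.
- by move=> j _; exists (j - k) => //; rewrite subrK.
Qed.

End L2OTheory.

(** * One half-step of the scheme *)

Section HalfStep.
Variables (R : realType) (a lam dx dt : R).
Hypothesis dt_gt0 : 0 < dt.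

Lemma alpha_ge0 (eps : R) : 0 < eps -> 0 <= alpha dt eps.
Proof. by move=> eps0; rewrite /alpha divr_ge0 ?addr_ge0 ?mulr_ge0 ?ltW. Qed.

Lemma alphaE (eps : R) : 0 < eps -> alpha dt eps = (1 + dt / (2 * eps))^-1.
Proof.
move=> eps0; have t0 := dt_gt0; rewrite /alpha; field.
by apply/andP; split; apply: lt0r_neq0; lra.
Qed.

Lemma alpha_le1 (eps : R) : 0 < eps -> alpha dt eps <= 1.
Proof.
move=> eps0; have t0 := dt_gt0; rewrite /alpha ler_pdivrMr; lra.
Qed.

Lemma alpha_le (eps : R) : 0 < eps -> alpha dt eps <= 2 / dt * eps.
Proof.
move=> eps0; have t0 := dt_gt0.
rewrite /alpha [leRHS]mulrAC ler_pM2l ?mulr_gt0// lef_pV2 ?posrE; lra.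
Qed.

Lemma exp_decay_ge0 (eps : R) : 0 <= expR (- (dt / (2 * eps))).
Proof. exact: expR_ge0. Qed.

Lemma exp_decay_le1 (eps : R) : 0 < eps -> expR (- (dt / (2 * eps))) <= 1.
Proof.
by move=> eps0; rewrite -expR0 ler_expR oppr_le0 divr_ge0 ?mulr_ge0 ?ltW.
Qed.

Lemma staggered_disequilibrium (eps : R) (Ul Ur : R * R) : 0 < eps ->
  let e := expR (- (dt / (2 * eps))) in
  let U := staggered_update a lam dx dt eps Ul Ur in
  U.2 - a * U.1 =
  alpha dt eps *
    ((Ul.2 - a * Ul.1 + (Ur.2 - a * Ur.1)) / 2
     - (lam ^+ 2 - a ^+ 2) * (dt / dx) / 2 * (Ur.1 - Ul.1)
     + a * (dt / dx) / 2
       * (e * ((Ur.2 - a * Ur.1) - (Ul.2 - a * Ul.1)))).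
Proof.
move=> eps0 e /=; rewrite /staggered_v /staggered_u -/e alphaE//.
have x0 : 1 + dt / (2 * eps) != 0.
  by rewrite lt0r_neq0// ltr_wpDr// divr_ge0 ?mulr_ge0 ?ltW.
move: (dt / dx) (dt / (2 * eps)) x0 => s x x0.
by field.
Qed.

Lemma staggered_error (eps : R) (Ul Ur : R * R) (ul ur : R) :
  let e := expR (- (dt / (2 * eps))) in
  staggered_u a dx dt eps Ul Ur - limit_update a dx dt ul ur =
  ((Ul.1 - ul) + (Ur.1 - ur)) / 2
  - a * (dt / dx) / 2 * ((Ur.1 - ur) - (Ul.1 - ul))
  - (dt / dx) / 2 * (e * ((Ur.2 - a * Ur.1) - (Ul.2 - a * Ul.1))).
Proof.
rewrite /staggered_u /limit_update /=.
by move: (expR _) (dt / dx) => e s; field.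
Qed.

(** The invariant of the scheme, for a family [U] of states indexed by [eps]
and an [eps]-independent approximation [ub] of their first component. *)
Definition close_to_limit (U : R -> int -> R * R) (ub : int -> R) : Prop :=
  [/\ l2O (fun=> 1) (fun eps j => (U eps (j + 1)).1 - (U eps j).1),
      l2O (alpha dt) (fun eps j => (U eps j).2 - a * (U eps j).1)
    & l2O (alpha dt) (fun eps j => (U eps j).1 - ub j)].

Lemma close_to_limit_shift (k : int) U ub : close_to_limit U ub ->
  close_to_limit (fun eps j => U eps (j + k)) (fun j => ub (j + k)).
Proof.
move=> [/(l2O_shift k) Du /(l2O_shift k) w /(l2O_shift k) d]; split => //.
by apply: eq_l2O Du => eps j _; rewrite addrAC.
Qed.

Lemma close_to_limit_half_step U ub : close_to_limit U ub ->
  close_to_limit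
    (fun eps => to_interfaces (staggered_update a lam dx dt eps) (U eps))
    (to_interfaces (limit_update a dx dt) ub).
Proof.
set s := dt / dx; set e := fun eps : R => expR (- (dt / (2 * eps))).
move=> [Du w d].
pose W eps j : R := (U eps j).2 - a * (U eps j).1.
have DuL := l2O_shift (-1) Du.
have dL := l2O_shift (-1) d.
have wL := l2O_shift (-1) w.
(* the flux correction [e (wr - wl)] is O(alpha) as e <= 1 *)
have ew : l2O (alpha dt) (fun eps j => e eps * (W eps j - W eps (j - 1))).
  apply: (l2OM (c := alpha dt) (M := 1)); last first.
    by apply: eq_l2O (l2OD w (l2OZ (-1) wL)) => eps j _; rewrite mulN1r.
  move=> eps eps0; rewrite normrM ler_wpM2r// ger0_norm ?exp_decay_ge0//.
  exact: exp_decay_le1.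
(* O(alpha) implies O(1) as alpha <= 1 *)
have O1 f : l2O (alpha dt) f -> l2O (fun=> 1) f.
  move=> H; apply: (@eq_l2O _ _ (fun eps j => 1 * f eps j)).
    by move=> eps j _; rewrite mul1r.
  apply: (l2OM (M := 1)) H => eps eps0.
  by rewrite !mul1r normr1 ger0_norm ?alpha_ge0// alpha_le1.
have W1 := O1 _ w; have W1L := O1 _ wL; have ew1 := O1 _ ew.
split.
- apply: eq_l2O (l2OD (l2OD (l2OZ (1 / 2 - a * s / 2) Du)
    (l2OZ (1 / 2 + a * s / 2) DuL))
    (l2OD (l2OZ (- (s / 2)) (l2O_shift 1 ew1)) (l2OZ (s / 2) ew1))).
  move=> eps j eps0; rewrite /to_interfaces /= /staggered_u -/s -/(e eps) /W.
  by rewrite addrK subrK; move: s (e eps) => s' e'; field.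
- have B : l2O (fun=> 1) (fun eps j =>
      (W eps (j - 1) + W eps j) / 2
      - (lam ^+ 2 - a ^+ 2) * s / 2 * ((U eps j).1 - (U eps (j - 1)).1)
      + a * s / 2 * (e eps * (W eps j - W eps (j - 1)))).
    apply: eq_l2O (l2OD (l2OD (l2OZ (1 / 2) (l2OD W1L W1))
      (l2OZ (- ((lam ^+ 2 - a ^+ 2) * s / 2)) DuL)) (l2OZ (a * s / 2) ew1)).
    by move=> eps j _; rewrite subrK /W; move: s (e eps) => s' e'; field.
  apply: (@eq_l2O _ _ _ _ _
    (l2OM (m := alpha dt) (c' := alpha dt) (M := 1) _ B)).
    by move=> eps j eps0; rewrite /to_interfaces staggered_disequilibrium.
  by move=> eps _; rewrite mulr1 mul1r.
- apply: eq_l2O (l2OD (l2OD (l2OZ (1 / 2 - a * s / 2) d)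
    (l2OZ (1 / 2 + a * s / 2) dL)) (l2OZ (- (s / 2)) ew)).
  move=> eps j _; rewrite /to_interfaces staggered_error -/s -/(e eps) /W.
  by move: s (e eps) => s' e'; field.
Qed.

(** * The whole scheme and its relative entropy *)

Lemma to_cellsE (S : Type) (F : S -> S -> S) (U : int -> S) (j : int) :
  to_cells F U j = to_interfaces F U (j + 1).
Proof. by rewrite /to_cells /to_interfaces addrK. Qed.

Lemma close_to_limit_staggered (u0 : int -> R) (n : nat) :
  (\esum_(j in [set: int]) ((u0 (j + 1) - u0 j) ^+ 2)%:E < +oo)%E ->
  close_to_limit (fun eps => staggered a lam dx dt eps u0 n)
    (limit_staggered a dx dt u0 n).
Proof.
move=> u0_summable; elim: n => [|n IHn].
  split.
  - exists (fine (\esum_(j in [set: int]) ((u0 (j + 1) - u0 j) ^+ 2)%:E)).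
      by rewrite fine_ge0// esum_ge0// => j _; rewrite lee_fin sqr_ge0.
    move=> eps _; rewrite expr1n mulr1 fineK//.
    rewrite ge0_fin_numE// esum_ge0// => j _; rewrite lee_fin sqr_ge0//.
  - by apply: eq_l2O (l2O0 _) => eps j _ /=; rewrite subrr.
  - by apply: eq_l2O (l2O0 _) => eps j _ /=; rewrite subrr.
have [Du w d] := close_to_limit_shift 1
  (close_to_limit_half_step (close_to_limit_half_step IHn)).
split; [apply: eq_l2O Du|apply: eq_l2O w|apply: eq_l2O d] => eps j _;
  by rewrite /staggered /limit_staggered !iterS !to_cellsE.
Qed.

Lemma rel_entropy_densityE (U : R * R) (ub : R) :
  rel_entropy_density a lam U ub =
  (lam ^+ 2 - a ^+ 2) * (U.1 - ub) ^+ 2 + (U.2 - a * U.1) ^+ 2.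
Proof.
rewrite /rel_entropy_density mxE big_ord_recl big_ord1 !mxE.
rewrite !big_ord_recl !big_ord0 !mxE /=; ring.
Qed.

Lemma subcharacteristic_ge0 : `|a| < lam -> 0 <= lam ^+ 2 - a ^+ 2.
Proof.
move=> alam; rewrite subr_ge0 -[a ^+ 2]real_normK ?num_real// lerXn2r ?nnegrE//.
- by rewrite ltW// (le_lt_trans _ alam).
- exact: ltW.
Qed.

Lemma Phi_rel_ge0 (u0 : int -> R) (N : nat) (eps : R) :
  0 < dx -> `|a| < lam -> (0 <= Phi_rel a lam dx dt u0 N eps)%E.
Proof.
move=> dx0 alam; apply: mule_ge0; first by rewrite lee_fin divr_ge0 ?ltW.
apply: esum_ge0 => j _.
rewrite lee_fin rel_entropy_densityE addr_ge0 ?sqr_ge0//.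
by rewrite mulr_ge0 ?sqr_ge0// subcharacteristic_ge0.
Qed.

Lemma Phi_rel_le_alpha (u0 : int -> R) (N : nat) : 0 < dx -> `|a| < lam ->
  (\esum_(j in [set: int]) ((u0 (j + 1) - u0 j) ^+ 2)%:E < +oo)%E ->
  exists2 C : R, 0 < C & forall eps : R, 0 < eps ->
    (Phi_rel a lam dx dt u0 N eps <= (C * alpha dt eps ^+ 2)%:E)%E.
Proof.
move=> dx0 alam /(@close_to_limit_staggered _ N)[_ [L L0 wL] [K K0 dK]].
have c0 := subcharacteristic_ge0 alam.
(* the summand 1 only makes the constant positive *)
exists (1 + dx / 2 * ((lam ^+ 2 - a ^+ 2) * K + L)).
  rewrite ltr_pwDl// mulr_ge0//; first by rewrite divr_ge0 ?ltW.
  by rewrite addr_ge0// mulr_ge0.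
move=> eps eps0; rewrite /Phi_rel.
apply: (@le_trans _ _ ((dx / 2)%:E
    * (((lam ^+ 2 - a ^+ 2) * (K * alpha dt eps ^+ 2))%:E
       + (L * alpha dt eps ^+ 2)%:E))%E).
  apply: lee_wpmul2l; first by rewrite lee_fin divr_ge0 ?ltW.
  under eq_esum => j _ do rewrite rel_entropy_densityE EFinD.
  rewrite esumD; last 2 first.
  - by move=> j _; rewrite lee_fin mulr_ge0// sqr_ge0.
  - by move=> j _; rewrite lee_fin sqr_ge0.
  apply: leeD; last exact: wL.
  by apply: le_esumZ => //; [move=> j; exact: sqr_ge0|exact: dK].
rewrite -EFinD -EFinM lee_fin -subr_ge0.
by rewrite [leRHS](_ : _ = alpha dt eps ^+ 2) ?sqr_ge0//; field.
Qed.

End HalfStep.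

Theorem mainTheorem5 (R : realType) (a lam dx dt : R) (N : nat)
  (u0 : int -> R)
  (lam_gt0 : 0 < lam) (a_lt_lam : `|a| < lam)
  (dx_gt0 : 0 < dx) (dt_gt0 : 0 < dt) (cfl : lam * (dt / dx) <= 1)
  (N_ge1 : (1 <= N)%N)
  (u0_summable :
     (\esum_(j in [set: int]) ((u0 (j + 1) - u0 j) ^+ 2)%:E < +oo)%E) :
  (exists2 C : R, 0 < C &
     forall eps : R, 0 < eps ->
       (Phi_rel a lam dx dt u0 N eps
        <= (C * (alpha dt eps ^+ 2 + Theta dt N eps ^+ 2))%:E)%E)
  /\ (fun eps : R => fine (Phi_rel a lam dx dt u0 N eps))
       =O_ (0^'+) (fun eps : R => eps ^+ 2).
Proof.
have [C C0 PhiC] := Phi_rel_le_alpha dt_gt0 N dx_gt0 a_lt_lam u0_summable.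
split.
  exists C => // eps eps0; apply: le_trans (PhiC eps eps0) _.
  by rewrite lee_fin ler_wpM2l ?(ltW C0)// lerDl sqr_ge0.
apply/eqO_exP; exists (C * (2 / dt) ^+ 2).
  by rewrite mulr_gt0// exprn_gt0// divr_gt0.
near=> eps.
have eps0 : 0 < eps by near: eps; exact: nbhs_right_gt.
have Phi0 : (0 <= Phi_rel a lam dx dt u0 N eps)%E by exact: Phi_rel_ge0.
rewrite !ger0_norm ?fine_ge0 ?sqr_ge0// -mulrA -exprMn.
rewrite -lee_fin fineK; last first.
  by rewrite ge0_fin_numE// (le_lt_trans (PhiC _ eps0))// ltry.
apply: le_trans (PhiC eps eps0) _.
rewrite lee_fin ler_wpM2l ?(ltW C0)// lerXn2r ?nnegrE ?alpha_ge0//.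
- by rewrite mulr_ge0 ?divr_ge0 ?ltW.
- exact: alpha_le.
Unshelve. all: by end_near.
Qed.
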